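(* Consider any one of the methods SM1, SM2, SM3 (defined in the context) applied with stepsize $h$ to the system $\ddot{x}(t)=\frac{1}{\varepsilon}\tilde{B}\dot{x}(t)+F(x(t))$, $F=-\nabla U$, producing $(x_{n+1},v_{n+1})$ from $(x_n,v_n)$, and put $p_{n}=v_{n}-\frac{1}{2\varepsilon}\tilde{B}x_{n}$ and $p_{n+1}=v_{n+1}-\frac{1}{2\varepsilon}\tilde{B}x_{n+1}$. Then, for the non-separable Hamiltonian $$H(x,p)=\frac12\Big|p+\frac{1}{2\varepsilon}\tilde{B}x\Big|^2+U(x),$$ the map $(x_n,p_n)\mapsto(x_{n+1},p_{n+1})$ determined by the method is symplectic, i.e. $\sum_{J=1}^{d}dx_{n+1}^{J}\wedge dp_{n+1}^{J}=\sum_{J=1}^{d}dx_n^{J}\wedge dp_n^{J}$, where the superscript $J$ denotes the $J$-th component.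
   Context: Setting: $d\ge 2$, $\tilde{B}$ is a real $d\times d$ skew-symmetric matrix, $0<\varepsilon\ll 1$ is a parameter, $U:\mathbb{R}^d\to\mathbb{R}$ has continuous second derivatives, $F(x)=-\nabla_xU(x)$, and $\Omega=\frac1\varepsilon\tilde{B}$. With $v=\dot x$ and $p=v-\frac{1}{2\varepsilon}\tilde{B}x$, the equation $\ddot{x}=\frac{1}{\varepsilon}\tilde{B}\dot{x}+F(x)$ is the Hamiltonian system with Hamiltonian $H$. The $\varphi$-functions are $\varphi_0(z)=e^z$ and $\varphi_k(z)=\int_0^1e^{(1-\sigma)z}\frac{\sigma^{k-1}}{(k-1)!}\,d\sigma$ for $k\ge1$, evaluated on matrices as entire functions. Methods. An $s$-stage adaptive exponential algorithm with stepsize $h$ is $$X_i=x_n+c_ih\varphi_1(c_ih\Omega)v_n+h^2\sum_{j=1}^s\alpha_{ij}(h\Omega)F(X_j),\quad i=1,\dots,s,$$ $$x_{n+1}=x_n+h\varphi_1(h\Omega)v_n+h^2\sum_{i=1}^s\beta_i(h\Omega)F(X_i),\qquad v_{n+1}=\varphi_0(h\Omega)v_n+h\sum_{i=1}^s\gamma_i(h\Omega)F(X_i).$$ The methods SM1–SM3 have coefficients, for $i=1,\dots,s$ and $j=1,\dots,i$, $$\alpha_{ij}=a_{ij}(c_i-c_j)\varphi_1((c_i-c_j)h\Omega),\quad \beta_i=b_i(1-c_i)\varphi_1((1-c_i)h\Omega),\quad \gamma_i=b_ie^{(1-c_i)h\Omega},$$ and $\alpha_{ij}=0$ for $j>i$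 (note $\alpha_{ii}=0$ automatically), with the choices: - SM1: $s=1$, $c_1=\frac12$, $b_1=1$; - SM2: $s=2$, $c_1=0$, $c_2=1$, $a_{21}=\frac12$, $b_1=b_2=\frac12$; - SM3: $s=2$, $c_1=\frac14$, $c_2=\frac34$, $a_{21}=\frac12$, $b_1=b_2=\frac12$. *)

(* Defs.v *)
From HB Require Import structures.
From mathcomp Require Import all_boot all_order all_algebra.
From mathcomp Require Import all_classical all_reals all_analysis.

Set Implicit Arguments.
Unset Strict Implicit.
Unset Printing Implicit Defensive.

Import Order.TTheory GRing.Theory Num.Theory.
Import numFieldNormedType.Exports.

Local Open Scope classical_set_scope.
Local Open Scope ring_scope.

Definition phi {R : realType} (k : nat) (z : R) : R :=
  if k is k'.+1 then
    Rintegral (@lebesgue_measure R) `[0, 1]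
      (fun s => expR ((1 - s) * z) * (s ^+ k' / k'`!%:R))
  else expR z.

(* Value at a square matrix of the entire function whose restriction to the
   real line is f: its Taylor series at 0, summed in the space of matrices. *)
Definition mxfun {R : realType} {d : nat} (f : R -> R) (A : 'M[R]_d) :
    'M[R]_d :=
  limn (series (fun k : nat => (derive1n k f 0 / k`!%:R) *: A ^+ k)).

Definition phim {R : realType} {d : nat} (k : nat) (A : 'M[R]_d) : 'M[R]_d :=
  mxfun (phi k) A.

Definition grad {R : realType} {d : nat} (U : 'cV[R]_d -> R) (x : 'cV[R]_d) :
    'cV[R]_d :=
  \col_i 'D_(delta_mx i 0) U x.

Definition C2 {R : realType} {d : nat} (U : 'cV[R]_d -> R) : Prop :=
  [/\ forall x, differentiable U x,
      forall x, differentiable (grad U) x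
    & forall i j : 'I_d,
        continuous (fun x => 'D_(delta_mx j 0) (fun y => grad U y i 0) x)].

Definition force {R : realType} {d : nat} (U : 'cV[R]_d -> R) (x : 'cV[R]_d) :
    'cV[R]_d :=
  - grad U x.

(* The coefficients of the stages and updates are functions of h * Omega. *)
Record exp_method (R : realType) (d : nat) := ExpMethod {
  stages : nat;
  node : 'I_stages -> R;
  alpha : 'I_stages -> 'I_stages -> 'M[R]_d -> 'M[R]_d;
  beta : 'I_stages -> 'M[R]_d -> 'M[R]_d;
  gamma : 'I_stages -> 'M[R]_d -> 'M[R]_d }.

(* (x', v') is obtained from (x, v) by one step of size h; X is the family of
   internal stages. *)
Definition exp_step {R : realType} {d : nat} (M : exp_method R d)
    (Omega : 'M[R]_d) (F : 'cV[R]_d -> 'cV[R]_d) (h : R)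
    (x v x' v' : 'cV[R]_d) : Prop :=
  exists X : 'I_(stages M) -> 'cV[R]_d,
  [/\ forall i, X i = x
        + (node i * h) *: (phim 1 ((node i * h) *: Omega) *m v)
        + h ^+ 2 *: \sum_j alpha i j (h *: Omega) *m F (X j),
      x' = x + h *: (phim 1 (h *: Omega) *m v)
        + h ^+ 2 *: \sum_i beta i (h *: Omega) *m F (X i)
    & v' = phim 0 (h *: Omega) *m v
        + h *: \sum_i gamma i (h *: Omega) *m F (X i)].

Definition SM_method {R : realType} (d s : nat) (c : 'I_s -> R)
    (a : 'I_s -> 'I_s -> R) (b : 'I_s -> R) : exp_method R d :=
  @ExpMethod R d s c
    (fun i j Z => if (j <= i)%N
       then (a i j * (c i - c j)) *: phim 1 ((c i - c j) *: Z) else 0)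
    (fun i Z => (b i * (1 - c i)) *: phim 1 ((1 - c i) *: Z))
    (fun i Z => b i *: phim 0 ((1 - c i) *: Z)).

(* The diagonal values a_ii are set to 0; they are multiplied by
   c_i - c_i = 0 in SM_method. *)
Definition SM1 (R : realType) (d : nat) : exp_method R d :=
  @SM_method R d 1 (fun=> 1 / 2) (fun _ _ => 0) (fun=> 1).

Definition SM2 (R : realType) (d : nat) : exp_method R d :=
  @SM_method R d 2 (fun i => [:: 0; 1]`_i)
    (fun i j => if (i == 1%N :> nat) && (j == 0%N :> nat) then 1 / 2 else 0)
    (fun=> 1 / 2).

Definition SM3 (R : realType) (d : nat) : exp_method R d :=
  @SM_method R d 2 (fun i => [:: 1 / 4; 3 / 4]`_i)
    (fun i j => if (i == 1%N :> nat) && (j == 0%N :> nat) then 1 / 2 else 0)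
    (fun=> 1 / 2).

Definition momentum {R : realType} {d : nat} (eps : R) (B : 'M[R]_d)
    (x v : 'cV[R]_d) : 'cV[R]_d :=
  v - (1 / (2 * eps)) *: (B *m x).

(* The Euclidean norm is spelled out because the library norm on matrices is
   the maximum norm. *)
Definition sqnorm {R : realType} {d : nat} (u : 'cV[R]_d) : R :=
  \sum_(i < d) u i 0 ^+ 2.

(* z = (x, p) *)
Definition hamiltonian {R : realType} {d : nat} (eps : R) (B : 'M[R]_d)
    (U : 'cV[R]_d -> R) (z : 'cV[R]_d * 'cV[R]_d) : R :=
  1 / 2 * sqnorm (z.2 + (1 / (2 * eps)) *: (B *m z.1)) + U z.1.

Definition wedge {R : realType} {V : Type} (a b : V -> R) (u w : V) : R :=
  a u * b w - a w * b u.

(* The 2-form sum_J d x'^J /\ d p'^J at z, where (x', p') = Phi z. *)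
Definition sum_dx_dp {R : realType} {d : nat}
    (Phi : 'cV[R]_d * 'cV[R]_d -> 'cV[R]_d * 'cV[R]_d)
    (z u w : 'cV[R]_d * 'cV[R]_d) : R :=
  \sum_(J < d) wedge ('d (fun y => (Phi y).1 J 0 : R) z)
                     ('d (fun y => (Phi y).2 J 0 : R) z) u w.

Definition symplectic {R : realType} {d : nat}
    (Phi : 'cV[R]_d * 'cV[R]_d -> 'cV[R]_d * 'cV[R]_d) : Prop :=
  (forall z, differentiable Phi z) /\
  forall z u w, sum_dx_dp Phi z u w = sum_dx_dp id z u w.

(* Main.v *)
Require Import Defs.
From HB Require Import structures.
From mathcomp Require Import all_boot all_order all_algebra.
From mathcomp Require Import all_classical all_reals all_analysis.
From mathcomp Require Import ring.

Set Implicit Arguments.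
Unset Strict Implicit.
Unset Printing Implicit Defensive.

Import Order.TTheory GRing.Theory Num.Theory.
Import numFieldNormedType.Exports.

Local Open Scope classical_set_scope.
Local Open Scope ring_scope.

(** Write Om = B / eps, E t = exp (t Om) and S t = t phi_1 (t Om), the integral
of E over [0, t].  In the variables (x, v) the equation is the superposition of
two flows that can be computed exactly: the free flow
(x, v) |-> (x + S t v, E t v) of the magnetic term, and the kick
(x, v) |-> (x, v + c F x) of the force.  When a_ij = b_j for j < i, as for
SM1-SM3, the method is a composition of such maps: the j-th stage flows to the
time c_j h, kicks with strength b_j h and flows back (conj_kick), and a last
free flow of duration h ends the step.  Unfolding this composition with the
cocycle rules E (s + t) = E s E t and S (s + t) = S s + S t E s gives the
formulas of the scheme (flow_kicks, exp_stepE).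

The substitution p = v - Om x / 2 turns the canonical form sum dx /\ dp into
the magnetic form sum dx /\ dv - (1/2) sum Om_ij dx_i /\ dx_j on the (x, v)
space (omega_canonical), so it suffices that each factor preserves the latter.
 - A kick does because F is a gradient, so that its derivative is symmetric;
   this is Schwarz's theorem (schwarz, hessian_tr), proved from the mean value
   theorem applied twice to a second difference.
 - The free flow does (flow_preserves) because Om S = E - 1 and, Om being skew,
   E^T = E(-t) and S^T = - S(-t).

All identities between E and S follow from E' = Om E, S' = E, E 0 = 1, S 0 = 0:
the difference of the two sides has derivative zero.  The two derivatives are
obtained by differentiating power series entry by entry, once the Taylor
coefficients of phi_1 are known to be 1 / (k + 1)!, which is differentiation
under the integral sign (phi1_taylor). *)

(** * Limits and power series of matrices *)
Lemma cvg_mx_coord (R : realType) (T : Type) (m n : nat) (G : set_system T)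
    {GF : Filter G} (F : T -> 'M[R]_(m, n)) (L : 'M[R]_(m, n)) :
  (forall i j, F k i j @[k --> G] --> L i j) -> F k @[k --> G] --> L.
Proof.
move=> FL; apply/cvgrPdist_lt => e e0; near=> k.
rewrite [ltLHS]/Num.Def.normr/= mx_normrE (bigmax_lt _ e0)//= => -[i j] _.
rewrite !mxE /=; move: i j; near: k.
apply: filter_forall => i; apply: filter_forall => j.
exact: ((cvgrPdist_lt _ _).1 (FL i j)).
Unshelve. all: by end_near. Qed.

Lemma mulmx_continuous (R : realType) (m n p : nat) (A : 'M[R]_(m, n)) :
  continuous (mulmx A : 'M[R]_(n, p) -> 'M[R]_(m, p)).
Proof.
move=> X; apply: (@cvg_mx_coord _ _ _ _ _ (nbhs_filter X)) => i j; rewrite mxE.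
under eq_cvg do rewrite mxE.
apply: (@cvg_big _ _ +%R 0 xpredT add_continuous) => l _.
by apply: cvgMl_tmp; exact: coord_continuous.
Qed.

Section ExponentialType.
Context {R : realType}.
Implicit Types (a : nat -> R).

(** Coefficients bounded like those of a multiple of the exponential series.
The class is stable under formal differentiation and its power series have
infinite radius of convergence, which is what termwise differentiation
needs. *)
Definition exp_type a := exists K C : R, [/\ 0 <= K, 0 <= C &
  forall k, `|a k| <= K * (C ^+ k / k`!%:R)].

Lemma exp_type_cvg a t : exp_type a -> cvgn (pseries a t).
Proof.
move=> [K [C [K0 C0 aC]]]; apply: normed_cvg.
apply: (@series_le_cvg _ _ (fun k => K * exp_coeff (C * `|t|) k)) => [k|k|k|].
- exact: normr_ge0.
- by rewrite mulr_ge0 // exp_coeff_ge0 // mulr_ge0.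
- rewrite /= normrM normrX /exp_coeff /= exprMn mulrAC mulrA.
  by rewrite ler_wpM2r ?exprn_ge0.
- have := @is_cvg_seriesZ R _ K (is_cvg_series_exp_coeff (C * `|t|)).
  exact.
Qed.

Lemma exp_type_diffs a : exp_type a -> exp_type (pseries_diffs a).
Proof.
move=> [K [C [K0 C0 aC]]]; exists (K * C), C; split => [||k] //.
  exact: mulr_ge0.
rewrite /pseries_diffs normrM ger0_norm //.
apply: (le_trans (ler_wpM2l _ (aC k.+1))) => //.
rewrite exprS factS natrM invfM le_eqVlt; apply/orP; left; apply/eqP.
rewrite mulrCA -!mulrA; congr (K * _); rewrite mulrCA; congr (C * _).
by rewrite mulrCA mulVKf.
Qed.

Lemma exp_type_is_derive a (t : R) : exp_type a ->
  is_derive t (1 : R) (fun t => limn (pseries a t))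
    (limn (pseries (pseries_diffs a) t)).
Proof.
move=> ea; apply: (@pseries_snd_diffs _ _ (`|t| + 1)).
- exact: exp_type_cvg.
- exact/exp_type_cvg/exp_type_diffs.
- exact/exp_type_cvg/exp_type_diffs/exp_type_diffs.
- by rewrite [ltRHS]ger0_norm ?addr_ge0 // ltrDl.
Qed.

Lemma lim_pseries0 a : limn (pseries a 0) = a 0%N.
Proof.
apply: lim_near_cst => //; exists 1%N => // -[//|n] _ /=.
rewrite /pseries /series /= big_nat_recl // expr0 mulr1 big1 ?addr0 // => i _.
by rewrite exprS mul0r mulr0.
Qed.

Lemma lim_pseries_shift a (t : R) : exp_type a ->
  limn (pseries (fun k => if k is k'.+1 then a k' else 0) t)
  = t * limn (pseries a t).
Proof.
move=> ea; apply: cvg_lim => //; rewrite -cvg_shiftS.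
rewrite [X in X @ _](_ : _ = fun n => t * pseries a t n).
  exact: (cvgMl_tmp (exp_type_cvg ea)).
apply/funext => n; rewrite /pseries /series /= big_nat_recl // mul0r add0r.
by rewrite mulr_sumr; apply: eq_bigr => i _; rewrite exprS mulrCA.
Qed.

End ExponentialType.

Section PowerEntries.
Context {R : realType} {d : nat}.
Implicit Types A : 'M[R]_d.

Definition mx_size A : R := \sum_i \sum_j `|A i j|.

Lemma mx_size_ge0 A : 0 <= mx_size A.
Proof. by do 2!(apply: sumr_ge0 => ? _). Qed.

Lemma mxpow_entry_le A k i j : `|(A ^+ k) i j| <= mx_size A ^+ k.
Proof.
elim: k i j => [|k IH] i j.
  by rewrite !expr0 mxE; case: (_ == _); rewrite ?normr1 ?normr0.
rewrite !exprS mxE (le_trans (ler_norm_sum _ _ _)) //.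
apply: (@le_trans _ _ (\sum_l `|A i l| * mx_size A ^+ k)).
  by apply: ler_sum => l _; rewrite normrM ler_wpM2l.
rewrite -mulr_suml ler_wpM2r ?exprn_ge0 ?mx_size_ge0 //.
rewrite /mx_size [leRHS](bigD1 i) //= lerDl.
by do 2!(apply: sumr_ge0 => ? _).
Qed.

Lemma exp_type_entry A (c : nat -> R) i j :
  (forall k, `|c k| <= k`!%:R^-1) -> exp_type (fun k => c k * (A ^+ k) i j).
Proof.
move=> cle; exists 1, (mx_size A); split=> [||k] //; first exact: mx_size_ge0.
rewrite mul1r normrM mulrC; apply: ler_pM => //; exact: mxpow_entry_le.
Qed.

Lemma mxpowZ A (t : R) k : (t *: A) ^+ k = t ^+ k *: A ^+ k.
Proof.
elim: k => [|k IH]; first by rewrite !expr0 scale1r.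
by rewrite !exprS IH -[LHS]scalemxAl -scalemxAr scalerA.
Qed.

(** Along the line t |-> t A, every entry of a matrix function is an ordinary
power series in t, to which termwise differentiation applies. *)
Lemma mxfunZE (f : R -> R) (c : nat -> R) A t i j :
  (forall k, derive1n k f 0 / k`!%:R = c k) ->
  (forall k, `|c k| <= k`!%:R^-1) ->
  mxfun f (t *: A) i j = limn (pseries (fun k => c k * (A ^+ k) i j) t).
Proof.
move=> fc cle.
pose L := \matrix_(i, j) limn (pseries (fun k => c k * (A ^+ k) i j) t).
have -> : mxfun f (t *: A) = L; last by rewrite mxE.
apply: cvg_lim => //; apply: cvg_mx_coord => {}i {}j; rewrite mxE.
have := @exp_type_cvg _ _ t (exp_type_entry A i j cle).
apply: cvg_trans; apply: near_eq_cvg; apply: nearW => n.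
rewrite /pseries /series /= summxE; apply: eq_bigr => k _.
by rewrite fc mxpowZ scalerA mxE mulrAC.
Qed.

End PowerEntries.

(** * Taylor coefficients of the phi-functions *)
Section PhiTaylor.
Context {R : realType}.
Local Notation mu := (@lebesgue_measure R).

(** The derivatives of phi_1: each differentiation under the integral sign
brings down a factor 1 - s. *)
Definition expR_moment (k : nat) (z : R) : R :=
  Rintegral mu `[0, 1] (fun s => (1 - s) ^+ k * expR ((1 - s) * z)).

Lemma phi1_moment : phi 1 = expR_moment 0 :> (R -> R).
Proof.
apply/funext => z; apply: eq_Rintegral => s _.
by rewrite !expr0 fact0 divr1 mulrC.
Qed.

Let is_derive_moment k (s z : R) :
  is_derive z 1 (fun z => (1 - s) ^+ k * expR ((1 - s) * z))
    ((1 - s) ^+ k.+1 * expR ((1 - s) * z)).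
Proof.
apply: is_derive_eq.
by rewrite [_%:A]mulr1 exprSr -mulrA; congr (_ * _); rewrite mulrC.
Qed.

Let moment_continuous k z :
  continuous (fun s : R => (1 - s) ^+ k * expR ((1 - s) * z)).
Proof.
move=> s; apply: cvgM.
  apply: (@continuous_comp _ _ _ (fun s : R => 1 - s) (fun x => x ^+ k)).
    by apply: cvgB; [exact: cvg_cst|exact: cvg_id].
  exact: exprn_continuous.
apply: (@continuous_comp _ _ _ (fun s : R => (1 - s) * z) expR).
  apply: cvgM; last exact: cvg_cst.
  by apply: cvgB; [exact: cvg_cst|exact: cvg_id].
exact: continuous_expR.
Qed.

Let moment_integrable k z : mu.-integrable `[0, 1]
  (EFin \o (fun s : R => (1 - s) ^+ k * expR ((1 - s) * z))).
Proof.
apply: continuous_compact_integrable; first exact: segment_compact.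
exact/continuous_subspaceT/moment_continuous.
Qed.

Lemma expR_moment_derive k : derive1 (expR_moment k) = expR_moment k.+1.
Proof.
apply/funext => z.
have moment' (x s : R) :
    partial1of2 (fun z s : R => (1 - s) ^+ k * expR ((1 - s) * z)) x s
    = (1 - s) ^+ k.+1 * expR ((1 - s) * x).
  by rewrite partial1of2E (@derive_val _ _ _ _ _ _ _ (is_derive_moment k s x)).
(* Domination on ]z - 1, z + 1[: there |(1 - s) x| <= |z| + 1 for s in
   [0, 1]. *)
rewrite /expR_moment (@differentiation_under_integral _ _ _ mu
  (fun z s : R => (1 - s) ^+ k * expR ((1 - s) * z)) `[0, 1] _ z (z - 1) (z + 1)
   _ (fun x _ => moment_integrable k x) _ (fun=> expR (`|z| + 1))) //=.
- by apply: eq_Rintegral => s _; rewrite moment'.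
- by rewrite in_itv /= ltrBlDr ltrDl ltr01.
- apply: continuous_compact_integrable; first exact: segment_compact.
  by apply: continuous_subspaceT => ?; exact: cvg_cst.
- move=> x s; rewrite !in_itv /= => /andP[zx xz] /andP[s0 s1].
  rewrite moment' normrM normrX (ger0_norm (expR_ge0 _)).
  have s01 : `|1 - s| <= 1 by rewrite ger0_norm ?subr_ge0 // lerBlDr lerDl.
  rewrite -[leRHS]mul1r; apply: ler_pM; rewrite ?exprn_ge0 ?expR_ge0 //.
    exact: exprn_ile1.
  rewrite ler_expR (le_trans (ler_norm _)) // normrM.
  rewrite -[leRHS]mul1r; apply: ler_pM => //.
  rewrite -[x](subrK z) addrC (le_trans (ler_normD _ _)) // lerD2l.
  by rewrite distrC ler_distlC (ltW zx) (ltW xz).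
Qed.

Lemma expR_moment0 k : expR_moment k 0 = k.+1%:R^-1.
Proof.
pose G : R -> R := (- k.+1%:R^-1) *: (cst 1 - id) ^+ k.+1.
have GE s : G s = - ((1 - s) ^+ k.+1 / k.+1%:R).
  by rewrite /G scalrfctE exprfctE -mulrN mulrC.
have dG (x : R) : is_derive x (1 : R) G ((1 - x) ^+ k).
  apply: is_derive_eq.
  by rewrite /= sub0r !scalerN scaleNr opprK [_ *: 1]mulr1 [LHS]mulKf.
have cG : continuous G.
  move=> x; apply/differentiable_continuous/derivable1_diffP.
  exact: (@ex_derive _ _ _ _ _ _ _ (dG x)).
have -> : expR_moment k 0 = Rintegral mu `[0, 1] (fun s => (1 - s) ^+ k).
  by apply: eq_Rintegral => s _; rewrite mulr0 expR0 mulr1.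
rewrite /Rintegral.
rewrite (@continuous_FTC2 _ (fun s => (1 - s) ^+ k) G) //.
- rewrite !GE subrr subr0 expr1n exprS mul0r mul0r oppr0 /=.
  by rewrite add0r opprK mul1r.
- apply: continuous_subspaceT => s.
  have := @moment_continuous k 0 s.
  by under eq_fun do rewrite mulr0 expR0 mulr1.
- split => [s _||].
  + exact: (@ex_derive _ _ _ _ _ _ _ (dG _)).
  + exact/cvg_at_right_filter/cG.
  + exact/cvg_at_left_filter/cG.
- by move=> s _; rewrite derive1E (@derive_val _ _ _ _ _ _ _ (dG _)).
Qed.

Lemma phi1_taylor k : derive1n k (phi 1) 0 / k`!%:R = k.+1`!%:R^-1 :> R.
Proof.
rewrite phi1_moment.
have -> : derive1n k (expR_moment 0) = expR_moment k.
  by elim: k => // k IH; rewrite derive1nS IH expR_moment_derive.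
by rewrite expR_moment0 factS natrM invfM.
Qed.

Lemma phi0_taylor k : derive1n k (phi 0) 0 / k`!%:R = k`!%:R^-1 :> R.
Proof.
have -> : derive1n k (phi 0) = expR :> (R -> R).
  elim: k => // k IH; rewrite derive1nS IH; apply/funext => x.
  by rewrite derive1E derive_val.
by rewrite expR0 mul1r.
Qed.

End PhiTaylor.

(** * Differentiation of matrix-valued curves *)
Section MatrixFlow.
Context {R : realType} {d : nat}.
Implicit Types M N : R -> 'M[R]_d.

Definition mx_derivative M M' :=
  forall (t : R) i j, is_derive t (1 : R) (fun t => M t i j) (M' t i j).

Lemma mx_derivative0_cst M : mx_derivative M (fun=> 0) -> forall s t, M s = M t.
Proof.
move=> dM s t; apply/matrixP => i j.
apply: (@is_derive_0_is_cst _ (fun t => M t i j)) => x.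
  by have := dM x i j; rewrite mxE.
Qed.

Lemma mx_derivativeM M M' N N' :
  mx_derivative M M' -> mx_derivative N N' ->
  mx_derivative (fun t => M t *m N t) (fun t => M' t *m N t + M t *m N' t).
Proof.
move=> dM dN t i j.
rewrite (_ : (fun t => _) = \sum_l ((fun t => M t i l) * (fun t => N t l j))).
  apply: is_derive_eq.
    by apply: is_derive_sum => l; exact: is_deriveM (dM t i l) (dN t l j).
  rewrite !mxE -big_split /=; apply: eq_bigr => l _.
  by rewrite addrC [_ *: M' _ _ _]mulrC.
by apply/funext => x; rewrite !mxE fct_sumE.
Qed.

Lemma mx_derivativeB M M' N N' :
  mx_derivative M M' -> mx_derivative N N' ->
  mx_derivative (fun t => M t - N t) (fun t => M' t - N' t).
Proof.
move=> dM dN t i j; rewrite !mxE.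
rewrite (_ : (fun t => _) = (fun t => M t i j) - (fun t => N t i j)).
  have dMi := dM t i j. have dNj := dN t i j. exact: is_deriveB.
by apply/funext => x; rewrite !mxE.
Qed.

Lemma mx_derivative_tr M M' : mx_derivative M M' ->
  mx_derivative (fun t => (M t)^T) (fun t => (M' t)^T).
Proof.
move=> dM t i j; rewrite mxE.
rewrite (_ : (fun t => _) = fun t => M t j i) //.
by apply/funext => x; rewrite mxE.
Qed.

Lemma mx_derivative_cst (A : 'M[R]_d) : mx_derivative (fun=> A) (fun=> 0).
Proof. by move=> t i j; rewrite mxE; exact: is_derive_cst. Qed.

Lemma mx_derivative_shift M M' s : mx_derivative M M' ->
  mx_derivative (fun t => M (s + t)) (fun t => M' (s + t)).
Proof.
move=> dM t i j.
have dMi := dM (s + t) i j.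
have ds : is_derive t (1 : R) (cst s + id) 1.
  by apply: is_derive_eq; rewrite add0r.
by have := is_derive1_comp dMi ds; rewrite mulr1.
Qed.

Lemma mx_derivativeN M M' : mx_derivative M M' ->
  mx_derivative (fun t => M (- t)) (fun t => - M' (- t)).
Proof.
move=> dM t i j.
have dMi := dM (- t) i j.
by have := is_derive1_comp dMi (is_deriveNid t (1 : R)); rewrite mulrN1 !mxE.
Qed.

End MatrixFlow.

(** * The free flow *)
Lemma lim_pseries_lincomb (R : realType) (n : nat) (c : 'I_n -> R)
    (a : 'I_n -> nat -> R) (t : R) :
  (forall l, exp_type (a l)) ->
  limn (pseries (fun k => \sum_l c l * a l k) t)
  = \sum_l c l * limn (pseries (a l) t).
Proof.
move=> ea; apply: cvg_lim => //.
rewrite [X in X @ _](_ : _ = fun k => \sum_l c l * pseries (a l) t k).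
  apply: (@cvg_big _ _ +%R 0 xpredT add_continuous) => l _.
  by apply: cvgMl_tmp; exact: (exp_type_cvg (t := t) (ea l)).
apply/funext => k; rewrite /pseries /series /=.
under [RHS]eq_bigr do rewrite mulr_sumr.
rewrite exchange_big /=; apply: eq_bigr => i _.
by rewrite mulr_suml; apply: eq_bigr => l _; rewrite mulrA.
Qed.

Section FreeFlow.
Context {R : realType} {d : nat} (Om : 'M[R]_d).

(** The blocks of the solution operator of x'' = Om x': at time t the velocity
is multiplied by flow_v t and the position moves by flow_x t applied to the
initial velocity. *)
Definition flow_v (t : R) : 'M[R]_d := phim 0 (t *: Om).
Definition flow_x (t : R) : 'M[R]_d := t *: phim 1 (t *: Om).

Let fact_inv_ge0 k : `|k`!%:R^-1 : R| <= k`!%:R^-1.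
Proof. by rewrite ger0_norm. Qed.

Let factS_inv_le k : `|k.+1`!%:R^-1 : R| <= k`!%:R^-1.
Proof.
rewrite ger0_norm // lef_pV2 ?posrE ?ltr0n ?fact_gt0 // ler_nat factS.
by rewrite leq_pmull.
Qed.

Let flow_vE t i j :
  flow_v t i j = limn (pseries (fun k => k`!%:R^-1 * (Om ^+ k) i j) t).
Proof. exact: mxfunZE phi0_taylor fact_inv_ge0. Qed.

(** The factor t of t phi_1(t Om) shifts the power series by one degree; this
makes flow_x a plain series, whose formal derivative is that of flow_v. *)
Definition flow_x_coef i j k : R :=
  if k is k'.+1 then k`!%:R^-1 * (Om ^+ k') i j else 0.

Let flow_xE t i j : flow_x t i j = limn (pseries (flow_x_coef i j) t).
Proof.
rewrite mxE /phim (mxfunZE _ _ _ _ phi1_taylor factS_inv_le).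
rewrite -(lim_pseries_shift t (exp_type_entry Om i j factS_inv_le)).
by congr (limn (pseries _ t)); apply/funext => -[].
Qed.

Let flow_x_exp_type i j : exp_type (flow_x_coef i j).
Proof.
exists 1, (1 + mx_size Om); have C0 := mx_size_ge0 Om.
split=> [||[|k]] //; rewrite ?addr_ge0 //=.
  by rewrite normr0 mul1r expr0 fact0 divr1.
rewrite mul1r normrM [leLHS]mulrC [X in _ * X]ger0_norm //.
rewrite ler_wpM2r ?invr_ge0 //.
rewrite (le_trans (mxpow_entry_le _ _ _ _)) //.
rewrite (@le_trans _ _ ((1 + mx_size Om) ^+ k)) //.
  by rewrite lerXn2r ?nnegrE ?addr_ge0 // lerDr.
by rewrite exprS ler_peMl ?exprn_ge0 ?addr_ge0 // lerDl.
Qed.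

Lemma flow_v_derivative : mx_derivative flow_v (fun t => Om *m flow_v t).
Proof.
move=> t i j.
rewrite (_ : (fun t => _) = fun t =>
  limn (pseries (fun k => k`!%:R^-1 * (Om ^+ k) i j) t)); last first.
  by apply/funext => x; rewrite flow_vE.
apply: is_derive_eq; first exact/exp_type_is_derive/exp_type_entry.
rewrite mxE; under eq_bigr do rewrite flow_vE.
rewrite -lim_pseries_lincomb; last by move=> l; exact: exp_type_entry.
congr (limn (pseries _ t)); apply/funext => k.
rewrite /pseries_diffs factS natrM invfM mulrA mulVKf // exprS mxE mulr_sumr.
by apply: eq_bigr => l _; rewrite mulrCA.
Qed.

Lemma flow_v_comm t : Om *m flow_v t = flow_v t *m Om.
Proof.
apply/matrixP => i j; rewrite !mxE.
under eq_bigr do rewrite flow_vE.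
under [RHS]eq_bigr do rewrite flow_vE mulrC.
rewrite -!lim_pseries_lincomb; [|by move=> l; exact: exp_type_entry..].
congr (limn (pseries _ t)); apply/funext => k.
have := exprSr Om k; rewrite exprS => /matrixP/(_ i j); rewrite !mxE => comm.
under eq_bigr do rewrite mulrCA.
rewrite -mulr_sumr comm mulr_sumr; apply: eq_bigr => l _.
by rewrite mulrA mulrC.
Qed.

Lemma flow_x_derivative : mx_derivative flow_x flow_v.
Proof.
move=> t i j.
rewrite (_ : (fun t => _) = fun t => limn (pseries (flow_x_coef i j) t));
  last by apply/funext => x; rewrite flow_xE.
apply: is_derive_eq; first exact/exp_type_is_derive/flow_x_exp_type.
rewrite flow_vE; congr (limn (pseries _ t)); apply/funext => k.
by rewrite /pseries_diffs /= factS natrM invfM -mulrA mulVKf.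
Qed.

Lemma flow_v0 : flow_v 0 = 1%:M.
Proof.
by apply/matrixP => i j; rewrite flow_vE lim_pseries0 expr0 fact0 invr1 mul1r.
Qed.

Lemma flow_x0 : flow_x 0 = 0.
Proof. exact: scale0r. Qed.

(** The derivative in t vanishes because flow_v (- t) commutes with Om, so the
product keeps its value at t = 0. *)
Let flow_vN_add b t : flow_v (- t) *m flow_v (b + t) = flow_v b.
Proof.
pose D t := flow_v (- t) *m flow_v (b + t).
have dD : mx_derivative D (fun=> 0).
  have := mx_derivativeM (mx_derivativeN flow_v_derivative)
            (mx_derivative_shift b flow_v_derivative).
  congr mx_derivative; apply/funext => x.
  by rewrite mulNmx flow_v_comm mulmxA addNr.
rewrite -/(D t) (mx_derivative0_cst dD t 0).
by rewrite /D oppr0 addr0 flow_v0 mul1mx.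
Qed.

Lemma flow_vN t : flow_v t *m flow_v (- t) = 1%:M.
Proof. by have := flow_vN_add 0 (- t); rewrite opprK add0r flow_v0. Qed.

Lemma flow_vD s t : flow_v (s + t) = flow_v s *m flow_v t.
Proof.
rewrite addrC -(flow_vN_add t s) mulmxA flow_vN mul1mx //.
Qed.

(** Displacements compose as a cocycle over the velocity flow; the companion
flow_xDr, with the product in the other order, says the same since the two
factors commute. *)
Lemma flow_xD s t : flow_x (s + t) = flow_x s + flow_v s *m flow_x t.
Proof.
pose D t := flow_x (s + t) - flow_v s *m flow_x t.
have dD : mx_derivative D (fun=> 0).
  have := mx_derivativeB (mx_derivative_shift s flow_x_derivative)
    (mx_derivativeM (mx_derivative_cst (flow_v s)) flow_x_derivative).
  by congr mx_derivative; apply/funext => x; rewrite mul0mx add0r flow_vD subrr.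
have /eqP := mx_derivative0_cst dD t 0.
by rewrite /D addr0 flow_x0 mulmx0 subr0 subr_eq => /eqP.
Qed.

Lemma flow_xDr s t : flow_x (s + t) = flow_x s + flow_x t *m flow_v s.
Proof.
pose D t := flow_x (s + t) - flow_x t *m flow_v s.
have dD : mx_derivative D (fun=> 0).
  have := mx_derivativeB (mx_derivative_shift s flow_x_derivative)
    (mx_derivativeM flow_x_derivative (mx_derivative_cst (flow_v s))).
  congr mx_derivative; apply/funext => x.
  by rewrite mulmx0 addr0 (addrC s) flow_vD subrr.
have /eqP := mx_derivative0_cst dD t 0.
by rewrite /D addr0 flow_x0 mul0mx subr0 subr_eq => /eqP.
Qed.

Lemma mul_flow_x t : Om *m flow_x t = flow_v t - 1%:M.
Proof.
pose D t := flow_v t - Om *m flow_x t.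
have dD : mx_derivative D (fun=> 0).
  have := mx_derivativeB flow_v_derivative
    (mx_derivativeM (mx_derivative_cst Om) flow_x_derivative).
  by congr mx_derivative; apply/funext => x; rewrite mul0mx add0r subrr.
have := mx_derivative0_cst dD t 0.
rewrite /D flow_x0 mulmx0 subr0 flow_v0 => <-.
by rewrite opprB addrC subrK.
Qed.

Hypothesis skew : Om^T = - Om.

(** E^T E has derivative E^T (Om^T + Om) E = 0: the magnetic term does no
work, so the velocity flow is orthogonal. *)
Lemma flow_v_tr t : (flow_v t)^T = flow_v (- t).
Proof.
pose D t := (flow_v t)^T *m flow_v t.
have dD : mx_derivative D (fun=> 0).
  have := mx_derivativeM (mx_derivative_tr flow_v_derivative) flow_v_derivative.
  congr mx_derivative; apply/funext => x.
  by rewrite trmx_mul skew mulmxN mulNmx mulmxA addNr.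
have := mx_derivative0_cst dD t 0.
rewrite /D flow_v0 trmx1 mul1mx => orth.
by rewrite -[LHS]mulmx1 -(flow_vN t) mulmxA orth mul1mx.
Qed.

Lemma flow_x_tr t : (flow_x t)^T = - flow_x (- t).
Proof.
pose D t := (flow_x t)^T - (0 - flow_x (- t)).
have dD : mx_derivative D (fun=> 0).
  have := mx_derivativeB (mx_derivative_tr flow_x_derivative)
    (mx_derivativeB (mx_derivative_cst 0) (mx_derivativeN flow_x_derivative)).
  congr mx_derivative; apply/funext => x.
  by rewrite flow_v_tr sub0r opprK subrr.
have /eqP := mx_derivative0_cst dD t 0.
by rewrite /D oppr0 flow_x0 trmx0 !sub0r !oppr0 subr_eq0 => /eqP.
Qed.

End FreeFlow.

(** * Symmetry of second derivatives *)
Section Schwarz.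
Context {R : realType} {V : normedModType R}.
Implicit Types (U : V -> R) (x a b : V).

Lemma is_derive_line U x a (s : R) : derivable U (x + s *: a) a ->
  is_derive s (1 : R) (fun s => U (x + s *: a)) ('D_a U (x + s *: a)).
Proof.
have quotE : (fun h : R => h^-1 *: ((U (x + (h *: 1 + s) *: a) : R)
    - U (x + s *: a))) =
    (fun h => h^-1 *: (U (h *: a + (x + s *: a)) - U (x + s *: a))).
  apply/funext => h; congr (_ *: (U _ - _)).
  by rewrite [h *: 1]mulr1 scalerDl addrCA.
move=> dU; apply: DeriveDef; first by rewrite /derivable quotE.
by rewrite /derive quotE.
Qed.

Let MVT_line U x a (t : R) : 0 < t -> (forall y, derivable U y a) ->
  exists2 s, 0 <= s <= t & U (x + t *: a) - U x = t * 'D_a U (x + s *: a).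
Proof.
move=> t0 dU; have dl s := is_derive_line (dU (x + s *: a)).
have [|s] := @MVT _ (fun s => U (x + s *: a)) _ 0 t t0 (fun s _ => dl s).
  apply: derivable_within_continuous => s _.
  exact: (@ex_derive _ _ _ _ _ _ _ (dl s)).
rewrite in_itv /= => /andP[/ltW s0 /ltW st].
rewrite scale0r addr0 subr0 mulrC => ->.
by exists s => //; rewrite s0.
Qed.

(** The mean value theorem is used along a for the difference of U between two
lines b apart, then along b for the derivative that it produces. *)
Lemma second_difference_MVT U x a b (t : R) : 0 < t ->
  (forall y, derivable U y a) -> (forall y, derivable ('D_a U) y b) ->
  exists r s : R, [/\ 0 <= r <= t, 0 <= s <= t &
    U (x + t *: a + t *: b) - U (x + t *: a) - (U (x + t *: b) - U x)
    = t ^+ 2 * 'D_b ('D_a U) (x + r *: a + s *: b)].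
Proof.
move=> t0 dU ddU.
pose D y := U (y + t *: b) - U y.
have D'E y : is_derive y a D ('D_a U (y + t *: b) - 'D_a U y).
  have dUy : is_derive y a U ('D_a U y) by exact: derivableP.
  have dUb : is_derive y a (U \o shift (t *: b)) ('D_a U (y + t *: b)).
    have quotE : (fun h : R => h^-1 *: ((U (h *: a + y + t *: b) : R)
          - U (y + t *: b))) =
        (fun h => h^-1 *: (U (h *: a + (y + t *: b)) - U (y + t *: b))).
      by apply/funext => h; rewrite addrA.
    apply: DeriveDef; first by rewrite /derivable /= quotE; exact: dU.
    by rewrite /derive /= quotE.
  exact: is_deriveB.
have [|r rt DE] := @MVT_line D x a t t0; first by move=> y; exact: ex_derive.
have [s st sE] := @MVT_line ('D_a U) (x + r *: a) b t t0 ddU.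
exists r, s; split => //.
move: DE; rewrite (@derive_val _ _ _ _ _ _ _ (D'E _)) sE mulrA => <-.
by [].
Qed.

(** The second difference does not change when a and b are exchanged, while
second_difference_MVT evaluates it as t^2 times either mixed derivative at a
point that tends to x with t. *)
Lemma schwarz U x a b :
  (forall y, derivable U y a) -> (forall y, derivable U y b) ->
  (forall y, derivable ('D_a U) y b) -> (forall y, derivable ('D_b U) y a) ->
  {for x, continuous ('D_b ('D_a U))} ->
  {for x, continuous ('D_a ('D_b U))} ->
  'D_b ('D_a U) x = 'D_a ('D_b U) x.
Proof.
move=> dUa dUb dUab dUba cab cba.
apply/eqP; rewrite -subr_eq0 -normr_le0; apply/ler_addgt0Pr => e e0.
have e20 : 0 < e / 2 by rewrite divr_gt0.
have /cvgrPdist_lt/(_ _ e20)/nbhs_ballP[d1 /= d10 near1] := cab.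
have /cvgrPdist_lt/(_ _ e20)/nbhs_ballP[d2 /= d20 near2] := cba.
pose del : R := Num.min d1 d2.
have d1le : del <= d1 by rewrite ge_min lexx.
have d2le : del <= d2 by rewrite ge_min lexx orbT.
have del0 : 0 < del by rewrite lt_min d10.
(* With t = del / N, every point of the parallelogram lies in the ball where
   both derivatives vary by less than e / 2. *)
pose N : R := `|a| + `|b| + 1.
have N0 : 0 < N by rewrite ltr_wpDl.
pose t : R := del / N; have t0 : 0 < t by rewrite divr_gt0.
have inball u v (r s : R) : `|u| + `|v| < N -> 0 <= r <= t -> 0 <= s <= t ->
    ball x del (x + r *: u + s *: v).
  move=> uv /andP[r0 rt] /andP[s0 st].
  rewrite -ball_normE /ball_ /= -addrA opprD addrA subrr sub0r normrN.
  apply: (le_lt_trans (ler_normD _ _)); rewrite !normrZ !ger0_norm //.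
  apply: (@le_lt_trans _ _ (t * (`|u| + `|v|))).
    by rewrite mulrDr lerD // ler_wpM2r.
  by rewrite /t mulrAC ltr_pdivrMr // ltr_pM2l.
have abN : `|a| + `|b| < N by rewrite ltrDl.
have baN : `|b| + `|a| < N by rewrite (addrC `|b|).
have [r [s [rt st E1]]] := second_difference_MVT x t0 dUa dUab.
have [r' [s' [rt' st' E2]]] := second_difference_MVT x t0 dUb dUba.
have := near1 _ (le_ball d1le (inball a b r s abN rt st)).
have := near2 _ (le_ball d2le (inball b a r' s' baN rt' st')).
have -> : 'D_b ('D_a U) (x + r *: a + s *: b)
    = 'D_a ('D_b U) (x + r' *: b + s' *: a).
  have t20 : t ^+ 2 != 0 by rewrite expf_neq0 ?gt_eqF.
  apply: (mulfI t20); apply: etrans (esym E1) (etrans _ E2).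
  rewrite (addrAC x (t *: b)).
  by rewrite !opprB addrACA [RHS]addrACA [- _ - _]addrC.
set c := 'D_a ('D_b U) (_ + _) => ltba ltab.
rewrite add0r -(subrKA c) (le_trans (ler_normD _ _)) // (splitr e).
by apply: lerD; [exact: ltW ltab|rewrite distrC; exact: ltW ltba].
Qed.

End Schwarz.

(** * Maps that preserve a 2-form *)
Section Symplectic.
Context {R : realType} {d : nat}.
Local Notation vec := 'cV[R]_d.
Local Notation phase := (vec * vec)%type.
Implicit Types (u w : phase) (Phi Psi : phase -> phase).

Definition omega u w : R := (u.1^T *m w.2 - u.2^T *m w.1) 0 0.

Lemma omegaE u w :
  omega u w = \sum_J (u.1 J 0 * w.2 J 0 - w.1 J 0 * u.2 J 0).
Proof.
rewrite /omega !mxE -sumrB; apply: eq_bigr => J _.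
by rewrite !mxE [u.2 J 0 * _]mulrC.
Qed.

Lemma is_diff_linear_comp (U V W : normedModType R) (L : {linear V -> W})
    (f df : U -> V) z : continuous L -> is_diff z f df ->
  is_diff z (L \o f) (L \o df).
Proof.
move=> cL fdf; have dL : is_diff (f z) L L.
  by apply: DiffDef; [exact: linear_differentiable|exact: diff_lin].
exact: is_diff_comp.
Qed.

Lemma is_diff_coord (U : normedModType R) (m n : nat) (f df : U -> 'M[R]_(m, n))
    z i j : is_diff z f df ->
  is_diff z (fun y => f y i j : R) (fun v => df v i j : R).
Proof.
move=> fdf.
have lin : linear (fun M : 'M[R]_(m, n) => M i j : R).
  by move=> k u w; rewrite !mxE.
pose coordM := GRing.isLinear.Build _ _ _ _ _ lin.
pose coordL : {linear 'M[R]_(m, n) -> R} :=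
  HB.pack (fun M : 'M[R]_(m, n) => M i j : R) coordM.
have cL : continuous coordL by exact: coord_continuous.
exact: (is_diff_linear_comp cL fdf).
Qed.

(** The pull-back of the canonical form is read off any witness of the
derivative, so that the differential operator never has to be computed. *)
Lemma sum_dx_dpE Phi D z u w : is_diff z Phi D ->
  sum_dx_dp Phi z u w = omega (D u) (D w).
Proof.
move=> dPhi.
have d1 J v : 'd (fun y => (Phi y).1 J 0 : R) z v = (D v).1 J 0.
  have cfst : continuous (@fst vec vec) by move=> y; exact: cvg_fst.
  have := is_diff_coord J 0 (is_diff_linear_comp cfst dPhi).
  by move/(@diff_val _ _ _ _ _ _) => /(congr1 (fun f => f v)).
have d2 J v : 'd (fun y => (Phi y).2 J 0 : R) z v = (D v).2 J 0.
  have csnd : continuous (@snd vec vec) by move=> y; exact: cvg_snd.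
  have := is_diff_coord J 0 (is_diff_linear_comp csnd dPhi).
  by move/(@diff_val _ _ _ _ _ _) => /(congr1 (fun f => f v)).
rewrite omegaE; apply: eq_bigr => J _.
rewrite /wedge; congr (_ * _ - _ * _);
  [exact: d1|exact: d2|exact: d1|exact: d2].
Qed.

(** The derivative is an existential witness and the form a parameter: the
factors of the method preserve the magnetic form, and only the conjugated map
the canonical one. *)
Definition preserves (form : phase -> phase -> R) Phi := forall z,
  exists2 D, is_diff z Phi D & forall u w, form (D u) (D w) = form u w.

Lemma preserves_symplectic Phi : preserves omega Phi -> symplectic Phi.
Proof.
move=> sPhi; split=> [z|z u w]; have [D dPhi oD] := sPhi z.
  exact: ex_diff.
by rewrite (sum_dx_dpE u w dPhi) oD (sum_dx_dpE u w (is_diff_id z)).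
Qed.

Lemma preserves_comp form Phi Psi :
  preserves form Phi -> preserves form Psi -> preserves form (Phi \o Psi).
Proof.
move=> sPhi sPsi z; have [D dPsi oD] := sPsi z.
have [D' dPhi oD'] := sPhi (Psi z).
by exists (D' \o D) => [|u w]; [exact: is_diff_comp|rewrite /= oD'].
Qed.

End Symplectic.

(** * The derivative of the force *)
Section Hessian.
Context {R : realType} {d : nat} (U : 'cV[R]_d -> R).

Definition hessian (x : 'cV[R]_d) : 'M[R]_d :=
  \matrix_(i, j) 'D_(delta_mx j 0) (fun y => grad U y i 0) x.

Lemma hessian_tr x : C2 U -> (hessian x)^T = hessian x.
Proof.
move=> [dU dgU cU]; apply/matrixP => i j; rewrite !mxE.
have gradE k : (fun y => grad U y k 0) = 'D_(delta_mx k 0) U.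
  by apply/funext => y; rewrite mxE.
have dg k y v : derivable ('D_(delta_mx k 0) U) y v.
  rewrite -gradE; apply: diff_derivable.
  have dgy : is_diff y (grad U) ('d (grad U) y) by apply: DiffDef.
  by case: (is_diff_coord k 0 dgy).
rewrite !gradE; apply: schwarz => [y|y|y|y||].
- exact: diff_derivable.
- exact: diff_derivable.
- exact: dg.
- exact: dg.
- by have := cU j i x; rewrite gradE.
- by have := cU i j x; rewrite gradE.
Qed.

Lemma is_diff_force x : C2 U ->
  is_diff x (force U) (fun u => - (hessian x *m u)).
Proof.
move=> [dU dgU cU].
have dg : is_diff x (grad U) ('d (grad U) x) by apply: DiffDef.
have -> : (fun u => - (hessian x *m u)) = - ('d (grad U) x : _ -> _).
  apply/funext => u; congr (- _); apply/matrixP => i j; rewrite (ord1 j) mxE.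
  have dgi := is_diff_coord i 0 dg.
  have uE : u = \sum_k u k 0 *: delta_mx k 0.
    rewrite [LHS]matrix_sum_delta; apply: eq_bigr => k _.
    by rewrite big_ord1.
  rewrite [in RHS]uE linear_sum summxE; apply: eq_bigr => k _.
  rewrite linearZ /= !mxE mulrC; congr (_ * _).
  rewrite deriveE; last by case: dgi.
  by case: dgi => _ /(congr1 (fun f => f (delta_mx k 0))).
exact: is_diffN.
Qed.

End Hessian.

(** * Kicks and free flows preserve the magnetic form *)
Section Magnetic.
Context {R : realType} {d : nat} (Om : 'M[R]_d).
Local Notation vec := 'cV[R]_d.
Local Notation phase := (vec * vec)%type.
Implicit Types u w z : phase.

(** The canonical form dx /\ dp written with the velocity v = p + Om x / 2. *)
Definition magnetic_form u w : R :=
  (u.1^T *m w.2 - u.2^T *m w.1 - u.1^T *m Om *m w.1) 0 0.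

Definition free_flow (t : R) z : phase :=
  (z.1 + flow_x Om t *m z.2, flow_v Om t *m z.2).

Definition kick (F : vec -> vec) (c : R) z : phase := (z.1, z.2 + c *: F z.1).

Lemma is_diff_fst z : is_diff z (@fst vec vec) (@fst vec vec).
Proof.
have cfst : continuous (@fst vec vec) by move=> y; exact: cvg_fst.
exact: (is_diff_linear_comp cfst (is_diff_id z)).
Qed.

Lemma is_diff_snd z : is_diff z (@snd vec vec) (@snd vec vec).
Proof.
have csnd : continuous (@snd vec vec) by move=> y; exact: cvg_snd.
exact: (is_diff_linear_comp csnd (is_diff_id z)).
Qed.

Lemma is_diff_mulmx (V : normedModType R) (A : 'M[R]_d) (f df : V -> vec)
    (z : V) :
  is_diff z f df -> is_diff z (fun y => A *m f y) (fun y => A *m df y).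
Proof. exact: (is_diff_linear_comp (@mulmx_continuous _ _ _ _ A)). Qed.

(** A kick changes the form by a multiple of the antisymmetric part of the
Hessian of the potential, which is zero. *)
Lemma kick_preserves U c : C2 U -> preserves magnetic_form (kick (force U) c).
Proof.
move=> hU z; exists (fun u => (u.1, u.2 + c *: - (hessian U z.1 *m u.1))).
  apply: is_diff_pair; first exact: is_diff_fst.
  apply: is_diffD; first exact: is_diff_snd.
  apply: is_diffZ.
  have dF := is_diff_comp (is_diff_fst z) (is_diff_force z.1 hU).
  exact: dF.
move=> u w; rewrite /magnetic_form /=; congr (fun_of_matrix (_ - _) 0 0).
set Hs := hessian U z.1.
have -> : (u.2 + c *: - (Hs *m u.1))^T = u.2^T - c *: (u.1^T *m Hs).
  by rewrite scalerN linearB linearZ /= trmx_mul hessian_tr.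
rewrite scalerN mulmxBr mulmxBl -scalemxAr -scalemxAl mulmxA.
by rewrite opprB addrA subrK.
Qed.

Hypothesis skew : Om^T = - Om.

(** Expanding the form at the images gives one block for each pair among
position and velocity.  The mixed blocks reduce to Om S = E - 1 and its
transpose, the velocity block vanishes by S^T = E^T S. *)
Lemma flow_preserves t : preserves magnetic_form (free_flow t).
Proof.
move=> z; exists (free_flow t).
  apply: is_diff_pair; last exact/is_diff_mulmx/is_diff_snd.
  apply: is_diffD; first exact: is_diff_fst.
  exact/is_diff_mulmx/is_diff_snd.
move=> [u1 u2] [w1 w2]; rewrite /magnetic_form /free_flow /=.
congr (fun_of_matrix _ 0 0).
set E := flow_v Om t; set S := flow_x Om t.
have OmS : Om *m S = E - 1%:M by exact: mul_flow_x.
have SOm : S^T *m Om = 1%:M - E^T.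
  by rewrite -[Om]opprK -skew mulmxN -trmx_mul OmS linearB /= trmx1 opprB.
have ES : E^T *m S = S^T.
  rewrite flow_v_tr // flow_x_tr //; apply/eqP.
  by rewrite -addr_eq0 addrC -flow_xD addNr flow_x0.
have -> : (u1 + S *m u2)^T = u1^T + u2^T *m S^T by rewrite linearD /= trmx_mul.
rewrite (trmx_mul E) !mulmxDl !mulmxDr.
have -> : u1^T *m Om *m (S *m w2) = u1^T *m (E *m w2) - u1^T *m w2.
  by rewrite mulmxA -(mulmxA _ Om) OmS mulmxBr mulmxBl mulmx1 mulmxA.
have -> : u2^T *m S^T *m Om *m (S *m w2)
    = u2^T *m S^T *m (E *m w2) - u2^T *m S^T *m w2.
  by rewrite mulmxA -(mulmxA _ Om) OmS mulmxBr mulmxBl mulmx1 mulmxA.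
have -> : u2^T *m S^T *m Om *m w1 = u2^T *m w1 - u2^T *m E^T *m w1.
  by rewrite -(mulmxA _ S^T) SOm mulmxBr mulmxBl mulmx1.
have -> : u2^T *m E^T *m (S *m w2) = u2^T *m S^T *m w2.
  by rewrite mulmxA -(mulmxA _ E^T) ES.
move: (u1^T *m (E *m w2)) (u2^T *m S^T *m (E *m w2)) (u2^T *m E^T *m w1)
  (u2^T *m S^T *m w2) (u1^T *m Om *m w1) (u1^T *m w2) (u2^T *m w1).
by move=> a1 a2 a3 a4 a5 a6 a7; apply/matrixP => i j; rewrite !mxE; ring.
Qed.

End Magnetic.

Arguments free_flow : simpl never.

(** * The schemes as compositions of flows and kicks *)
Section Methods.
Context {R : realType} {d : nat} (Om : 'M[R]_d).
Local Notation vec := 'cV[R]_d.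
Local Notation phase := (vec * vec)%type.
Local Notation S := (flow_x Om).
Local Notation E := (flow_v Om).
Variables (F : vec -> vec) (h : R) (c b : nat -> R).

(** Flowing back after each kick refers the state to the beginning of the step,
so that each factor depends on its own node only. *)
Definition conj_kick (j : nat) : phase -> phase :=
  free_flow Om (- (c j * h)) \o kick F (b j * h) \o free_flow Om (c j * h).

Fixpoint kicks (k : nat) (z : phase) : phase :=
  if k is k'.+1 then conj_kick k' (kicks k' z) else z.

Definition stage (z : phase) (k : nat) : vec :=
  (free_flow Om (c k * h) (kicks k z)).1.

Lemma free_flow0 z : free_flow Om 0 z = z.
Proof.
by rewrite /free_flow flow_x0 flow_v0 mul0mx mul1mx addr0 -surjective_pairing.
Qed.

Lemma free_flow_comp s t z :
  free_flow Om t (free_flow Om s z) = free_flow Om (s + t) z.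
Proof.
rewrite /free_flow flow_xDr mulmxDl addrA -mulmxA; congr (_, _).
by rewrite mulmxA -flow_vD addrC.
Qed.

Lemma free_flowD t z y :
  free_flow Om t (z + y) = free_flow Om t z + free_flow Om t y.
Proof. by rewrite /free_flow !mulmxDr addrACA. Qed.

Lemma conj_kickE j z :
  conj_kick j z =
  z + free_flow Om (- (c j * h))
        (0, (b j * h) *: F (free_flow Om (c j * h) z).1).
Proof.
set y := free_flow Om (c j * h) z.
have -> : conj_kick j z = free_flow Om (- (c j * h)) (kick F (b j * h) y) by [].
have -> : kick F (b j * h) y = y + (0, (b j * h) *: F y.1).
  by rewrite [in RHS](surjective_pairing y) /kick; congr (_, _); rewrite addr0.
by rewrite free_flowD {1}/y free_flow_comp subrr free_flow0.
Qed.

(** Variation of constants: a kick of strength b_j h at time c_j h contributes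
to the state at time t its free evolution during t - c_j h. *)
Lemma flow_kicks t k z :
  free_flow Om t (kicks k z) = free_flow Om t z
  + \sum_(j < k) free_flow Om (t - c j * h) (0, (b j * h) *: F (stage z j)).
Proof.
elim: k => [|k IH]; first by rewrite big_ord0 addr0.
rewrite big_ord_recr [kicks _ _]/= conj_kickE free_flowD IH -addrA.
by rewrite free_flow_comp [- _ + t]addrC.
Qed.

Lemma phim1_scale (t r : R) (g : vec) :
  h ^+ 2 *: ((r * t) *: phim 1 (t *: (h *: Om)) *m g)
  = (r * h) *: (S (t * h) *m g).
Proof.
rewrite /flow_x !scalemxAl !scalerA; congr (_ *: _ *m _).
by ring.
Qed.

Lemma phim0_scale (t r : R) (g : vec) :
  h *: (r *: phim 0 (t *: (h *: Om)) *m g) = (r * h) *: (E (t * h) *m g).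
Proof. by rewrite /flow_v !scalemxAl !scalerA [r * h]mulrC. Qed.

Variables (s : nat) (a : 'I_s -> 'I_s -> R).
Hypothesis ab : forall i j : 'I_s, (j < i)%N -> a i j = b j.
Let M := @SM_method R d s c a b.

(** The stage equations are explicit, also on the diagonal, where the
coefficient carries the factor c_i - c_i. *)
Let alpha_ge (i j : 'I_s) Z : (i <= j)%N -> alpha (e := M) i j Z = 0.
Proof.
rewrite /= leq_eqVlt => /orP[/eqP/val_inj ->|ij]; last by rewrite leqNgt ij.
by rewrite leqnn subrr mulr0 scale0r.
Qed.

Let alpha_sum (i : 'I_s) (g : nat -> vec) :
  h ^+ 2 *: \sum_(j < s) alpha (e := M) i j (h *: Om) *m g j
  = \sum_(j < i) (b j * h) *: (S (c i * h - c j * h) *m g j).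
Proof.
rewrite (big_ord_widen s
  (fun j => (b j * h) *: (S (c i * h - c j * h) *m g j)) (ltnW (ltn_ord i))).
rewrite scaler_sumr [RHS]big_mkcond; apply: eq_bigr => j _.
case: (ltnP j i) => [ji|ij]; last by rewrite alpha_ge // mul0mx scaler0.
by rewrite /= (ltnW ji) (ab ji) phim1_scale mulrBl.
Qed.

(** The family of internal stages is unique, by strong induction on the index,
and consists of the positions at which the kicks are evaluated. *)
Lemma exp_stepE x v x' v' :
  exp_step M Om F h x v x' v' <->
  free_flow Om h (kicks s (x, v)) = (x', v').
Proof.
have fst_kicks t k : (free_flow Om t (kicks k (x, v))).1
    = x + S t *m v
      + \sum_(j < k) (b j * h) *: (S (t - c j * h) *m F (stage (x, v) j)).
  rewrite flow_kicks [LHS]/= raddf_sum; congr (_ + _); apply: eq_bigr => j _.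
  by rewrite /free_flow /= add0r scalemxAr.
have snd_kicks t k : (free_flow Om t (kicks k (x, v))).2
    = E t *m v
      + \sum_(j < k) (b j * h) *: (E (t - c j * h) *m F (stage (x, v) j)).
  rewrite flow_kicks [LHS]/= raddf_sum; congr (_ + _); apply: eq_bigr => j _.
  by rewrite /free_flow /= scalemxAr.
have step_sums : free_flow Om h (kicks s (x, v)) =
  (x + h *: (phim 1 (h *: Om) *m v) + h ^+ 2 *: \sum_(i < s)
     beta (e := M) i (h *: Om) *m F (stage (x, v) i),
   phim 0 (h *: Om) *m v + h *: \sum_(i < s)
     gamma (e := M) i (h *: Om) *m F (stage (x, v) i)).
  rewrite [LHS]surjective_pairing fst_kicks snd_kicks; congr (_, _).
    rewrite /flow_x scalemxAl; congr (_ + _); rewrite scaler_sumr.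
    by apply: eq_bigr => i _ /=; rewrite phim1_scale mulrBl mul1r.
  congr (_ + _); rewrite scaler_sumr.
  by apply: eq_bigr => i _ /=; rewrite phim0_scale mulrBl mul1r.
have stageE (i : 'I_s) : stage (x, v) i
    = x + (c i * h) *: (phim 1 ((c i * h) *: Om) *m v)
      + h ^+ 2 *: \sum_(j < s)
        alpha (e := M) i j (h *: Om) *m F (stage (x, v) j).
  rewrite (alpha_sum i (fun j => F (stage (x, v) j))).
  by rewrite /stage fst_kicks /flow_x scalemxAl.
rewrite step_sums; split=> [[X [XE -> ->]]|[<- <-]]; last first.
  by exists (fun i => stage (x, v) i); split => // i; exact: stageE.
have XS (i : 'I_s) : X i = stage (x, v) i.
  have [n] := ubnP i; elim: n i => // n IH i /ltnSE-le_in.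
  rewrite XE stageE; congr (_ + _ *: _); apply: eq_bigr => j _.
  have [ji|ij] := ltnP j i; first by rewrite (IH j (leq_trans ji le_in)).
  by rewrite !alpha_ge // !mul0mx.
by congr (_ + _ *: _, _ + _ *: _); apply: eq_bigr => i _; rewrite XS.
Qed.

End Methods.

(** * Symplecticity in canonical variables *)
Section Assembly.
Context {R : realType} {d : nat}.
Local Notation vec := 'cV[R]_d.
Local Notation phase := (vec * vec)%type.

Lemma kicks_preserves (Om : 'M[R]_d) U h c b k : Om^T = - Om -> C2 U ->
  preserves (magnetic_form Om) (kicks Om (force U) h c b k).
Proof.
move=> skew hU; elim: k => [|k IH].
  by move=> z; exists id => //; exact: is_diff_id.
apply: preserves_comp IH; apply: preserves_comp; last exact: flow_preserves.
by apply: preserves_comp; [exact: flow_preserves|exact: kick_preserves].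
Qed.

Definition canonical_of (Th : 'M[R]_d) (z : phase) : phase :=
  (z.1, z.2 - Th *m z.1).

Definition velocity_of (Th : 'M[R]_d) (z : phase) : phase :=
  (z.1, z.2 + Th *m z.1).

Lemma velocity_ofK Th : cancel (velocity_of Th) (canonical_of Th).
Proof. by move=> [x p]; rewrite /canonical_of /= addrK. Qed.

Lemma canonical_ofK Th : cancel (canonical_of Th) (velocity_of Th).
Proof. by move=> [x v]; rewrite /velocity_of /= subrK. Qed.

(** The shear by Th contributes the term - Th + Th^T = - 2 Th in the
positions: half of the magnetic field in p gives the whole field in v. *)
Lemma omega_canonical Th u w : Th^T = - Th ->
  omega (canonical_of Th u) (canonical_of Th w) = magnetic_form (Th + Th) u w.
Proof.
move=> skew; case: u w => [u1 u2] [w1 w2].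
rewrite /omega /magnetic_form /=; congr (fun_of_matrix _ 0 0).
have -> : (u2 - Th *m u1)^T = u2^T + u1^T *m Th.
  by rewrite linearB /= trmx_mul skew mulmxN opprK.
rewrite mulmxBr !mulmxDl mulmxDr mulmxDl mulmxA !opprD !addrA.
by rewrite [X in X - _ = _]addrAC.
Qed.

Lemma preserves_canonical Th Phi : Th^T = - Th ->
  preserves (magnetic_form (Th + Th)) Phi ->
  preserves omega (canonical_of Th \o Phi \o velocity_of Th).
Proof.
move=> skew sPhi z.
have dV y : is_diff y (velocity_of Th) (velocity_of Th).
  apply: is_diff_pair; first exact: is_diff_fst.
  apply: is_diffD; first exact: is_diff_snd.
  exact/is_diff_mulmx/is_diff_fst.
have dC y : is_diff y (canonical_of Th) (canonical_of Th).
  apply: is_diff_pair; first exact: is_diff_fst.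
  apply: is_diffB; first exact: is_diff_snd.
  exact/is_diff_mulmx/is_diff_fst.
have [D dPhi oD] := sPhi (velocity_of Th z).
exists (canonical_of Th \o D \o velocity_of Th) => [|u w].
  exact: is_diff_comp.
rewrite [LHS]omega_canonical // oD -omega_canonical //.
by rewrite !velocity_ofK.
Qed.

(** The condition on a says that stage i sees exactly the kicks of the stages
before it, with the weights with which they enter the final update. *)
Lemma SM_method_symplectic (B : 'M[R]_d) (eps : R) (U : vec -> R) (h : R)
    (s : nat) (c b : nat -> R) (a : 'I_s -> 'I_s -> R) :
  B^T = - B -> C2 U -> (forall i j : 'I_s, (j < i)%N -> a i j = b j) ->
  exists Phi : phase -> phase,
    (forall x v x' v' : vec,
       exp_step (SM_method d (fun i : 'I_s => c i) a (fun i : 'I_s => b i))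
         (eps^-1 *: B) (force U) h x v x' v' <->
       Phi (x, momentum eps B x v) = (x', momentum eps B x' v')) /\
    symplectic Phi.
Proof.
move=> hB hU hab; pose Th := (1 / (2 * eps)) *: B.
have ThT : Th^T = - Th by rewrite linearZ /= hB scalerN.
have OmE : eps^-1 *: B = Th + Th.
  by rewrite -scalerDl mul1r invfM -mulr2n -[_ *+ 2]mulr_natl mulVKf.
have OmT : (Th + Th)^T = - (Th + Th) by rewrite linearD /= ThT opprD.
pose Psi := free_flow (Th + Th) h \o kicks (Th + Th) (force U) h c b s.
have momE x v : (x, momentum eps B x v) = canonical_of Th (x, v).
  by rewrite /canonical_of /momentum /= scalemxAl.
exists (canonical_of Th \o Psi \o velocity_of Th); split; last first.
  apply/preserves_symplectic/preserves_canonical => //.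
  by apply: preserves_comp; [exact: flow_preserves|exact: kicks_preserves].
move=> x v x' v'; rewrite OmE (exp_stepE _ _ _ _ hab) !momE.
rewrite /comp canonical_ofK -[free_flow _ _ _]/(Psi (x, v)).
by split=> [->|/(can_inj (canonical_ofK Th))].
Qed.

End Assembly.

Theorem theorem3p1 (R : realType) (d : nat) (hd : (2 <= d)%N)
    (B : 'M[R]_d) (hB : B^T = - B) (eps : R) (heps : 0 < eps)
    (U : 'cV[R]_d -> R) (hU : C2 U)
    (H : 'cV[R]_d * 'cV[R]_d -> R) (hH : H = hamiltonian eps B U)
    (M : exp_method R d) (hM : M = SM1 R d \/ M = SM2 R d \/ M = SM3 R d)
    (h : R) (hh : 0 < h) :
  exists Phi : 'cV[R]_d * 'cV[R]_d -> 'cV[R]_d * 'cV[R]_d,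
    (forall x v x' v' : 'cV[R]_d,
       exp_step M (eps^-1 *: B) (force U) h x v x' v' <->
       Phi (x, momentum eps B x v) = (x', momentum eps B x' v')) /\
    symplectic Phi.
Proof.
case: hM => [->|[->|->]].
- apply: (@SM_method_symplectic _ _ _ _ _ _ 1 (fun=> 1 / 2) (fun=> 1)) => //.
  by move=> i j; rewrite !ord1.
- apply: (@SM_method_symplectic _ _ _ _ _ _ 2 (fun i => [:: 0; 1]`_i)
    (fun=> 1 / 2)) => //.
  by move=> [[|[|//]] ?] [[|[|//]] ?].
- apply: (@SM_method_symplectic _ _ _ _ _ _ 2 (fun i => [:: 1 / 4; 3 / 4]`_i)
    (fun=> 1 / 2)) => //.
  by move=> [[|[|//]] ?] [[|[|//]] ?].
Qed.
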